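(* Let $X$ and $Y$ be Banach spaces over $\mathbb{K}$ ($=\mathbb{R}$ or $\mathbb{C}$) and suppose that $n(Y)=1$. If $X\oplus_\infty Y$ has the weak BPBp-nu with a function $\eta$, then the pair $(X,Y)$ has the BPBZp with the function $\gamma(\varepsilon)=\eta\left(\frac{\varepsilon}{4+\varepsilon}\right)$ for $0<\varepsilon<1$.
   Context: $S_X$ is the unit sphere of a Banach space $X$, $X^*$ its topological dual, $\mathcal{L}(X,Y)$ the bounded linear operators from $X$ to $Y$, $\mathcal{L}(X)=\mathcal{L}(X,X)$. $X\oplus_\infty Y$ is $X\times Y$ with norm $\max\{\|x\|,\|y\|\}$. Let $\Pi(X)=\{(x,x^* )\in S_X\times S_{X^*}: x^*(x)=1\}$; for $T\in\mathcal{L}(X)$ the numerical radius is $\nu(T)=\sup\{|x^*(Tx)|:(x,x^* )\in\Pi(X)\}$, and the numerical index of $X$ is $n(X)=\inf\{\nu(T):T\in\mathcal{L}(X),\ \|T\|=1\}$. Weak BPBp-nu: a Banach space $Z$ has the weak BPBp-nu with a function $\eta$ if for every $0<\varepsilon<1$ one has $\eta(\varepsilon)>0$ and, whenever $T\in\mathcal{L}(Z)$ and $(z_0,z_0^* )\in\Pi(Z)$ satisfy $\nu(T)=1$ and $|z_0^*(Tz_0)|>1-\eta(\varepsilon)$, there exist $S\in\mathcal{L}(Z)$ and $(z_1,z_1^* )\in\Pi(Z)$ such that $\nu(S)=|z_1^*(Sz_1)|$, $\|S-T\|<\varepsilon$, $\|z_1-z_0\|<\varepsilon$ and $\|z_1^*-z_0^*\|<\varepsilon$.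 BPBZp: the pair $(X,Y)$ has the BPBZp with the function $\gamma$ (for $0<\varepsilon<1$) if for each such $\varepsilon$ one has $\gamma(\varepsilon)>0$ and, whenever $T\in\mathcal{L}(X,Y)$ with $\|T\|=1$, $y_0^*\in S_{Y^*}$ and $x_0\in S_X$ satisfy $|y_0^*(Tx_0)|>1-\gamma(\varepsilon)$, there exist $y_1^*\in S_{Y^*}$, $x_1\in S_X$ and $S\in\mathcal{L}(X,Y)$ with $\|S\|=|y_1^*(Sx_1)|=1$, $\|x_1-x_0\|<\varepsilon$, $\|y_1^*-y_0^*\|<\varepsilon$ and $\|S-T\|<\varepsilon$. *)

(* Defs.v *)
From HB Require Import structures.
From mathcomp Require Import all_boot all_order all_algebra.
From mathcomp Require Import complex.
From mathcomp Require Import all_classical all_reals all_analysis.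

Set Implicit Arguments.
Unset Strict Implicit.
Unset Printing Implicit Defensive.

Import Order.TTheory GRing.Theory Num.Theory.
Import numFieldNormedType.Exports.

Local Open Scope classical_set_scope.
Local Open Scope ring_scope.

Variant scalar_kind := RealScalars | ComplexScalars.

Definition scalars (R : realType) (k : scalar_kind) : numFieldType :=
  match k with
  | RealScalars => R
  | ComplexScalars => complex R
  end.

Definition scalar_re (R : realType) (k : scalar_kind) : scalars R k -> R :=
  match k with
  | RealScalars => fun z => z
  | ComplexScalars => fun z => complex.Re z
  end.

Section BanachSpaces.
Context {R : realType} {k : scalar_kind}.
Local Notation K := (scalars R k).

(* In a normed module over K the library's norm takes its values in K, as
   nonnegative real elements; rnorm is the same norm with values in R. *)
Definition rnorm (V : normedModType K) (v : V) : R := scalar_re `|v|.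

(* The elements of L(X, Y) are the T : {linear X -> Y} with continuous T, and
   those of the dual of X are the bounded operators from X to K^o. *)
Definition opnorm (X Y : normedModType K) (T : X -> Y) : R :=
  sup [set rnorm (T x) | x in [set x | rnorm x <= 1]].

Definition unit_sphere (X : normedModType K) : set X := [set x | rnorm x = 1].

Definition dual_unit_sphere (X : normedModType K) : set {linear X -> K^o} :=
  [set f | continuous f /\ opnorm f = 1].

Definition state_pairs (X : normedModType K) : set (X * {linear X -> K^o}) :=
  [set p | [/\ unit_sphere p.1, dual_unit_sphere p.2 & p.2 p.1 = 1]].

Definition numerical_radius (X : normedModType K) (T : X -> X) : R :=
  sup [set rnorm (p.2 (T p.1)) | p in @state_pairs X].

(* On the zero space there is no operator of norm 1, and inf set0 = 0. *)
Definition numerical_index (X : normedModType K) : R :=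
  inf [set numerical_radius T | T in
         [set T : {linear X -> X} | continuous T /\ opnorm T = 1]].

(* Stated on normedModType because the library has no complete instance on
   X * Y; its norm on X * Y is the maximum norm, i.e. that of the l_infty-sum. *)
Definition weak_BPBp_nu (Z : normedModType K) (eta : R -> R) : Prop :=
  forall eps : R, 0 < eps < 1 ->
    0 < eta eps /\
    forall (T : {linear Z -> Z}) (z0 : Z) (f0 : {linear Z -> K^o}),
      continuous T -> state_pairs (z0, f0) ->
      numerical_radius T = 1 -> 1 - eta eps < rnorm (f0 (T z0)) ->
      exists (S : {linear Z -> Z}) (z1 : Z) (f1 : {linear Z -> K^o}),
        [/\ continuous S, state_pairs (z1, f1) &
            numerical_radius S = rnorm (f1 (S z1))] /\
        [/\ opnorm (S \- T) < eps, rnorm (z1 - z0) < eps &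
            opnorm (f1 \- f0) < eps].

Definition BPBZp (X Y : normedModType K) (gamma : R -> R) : Prop :=
  forall eps : R, 0 < eps < 1 ->
    0 < gamma eps /\
    forall (T : {linear X -> Y}) (g0 : {linear Y -> K^o}) (x0 : X),
      continuous T -> opnorm T = 1 ->
      dual_unit_sphere g0 -> unit_sphere x0 ->
      1 - gamma eps < rnorm (g0 (T x0)) ->
      exists (g1 : {linear Y -> K^o}) (x1 : X) (S : {linear X -> Y}),
        [/\ dual_unit_sphere g1, unit_sphere x1, continuous S,
            opnorm S = 1 & rnorm (g1 (S x1)) = 1] /\
        [/\ rnorm (x1 - x0) < eps, opnorm (g1 \- g0) < eps &
            opnorm (S \- T) < eps].

End BanachSpaces.

(* Main.v *)
Require Import Defs.
From HB Require Import structures.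
From mathcomp Require Import all_boot all_order all_algebra.
From mathcomp Require Import complex ring lra.
From mathcomp Require Import all_classical all_reals all_analysis.

(* Write Z for the l_infty-sum of X and Y, and (x0, g0) for the given data.  The
   operator (x, y) |-> (0, T x) on Z has numerical radius ||T||.  By the theorem
   of Bishop and Phelps, g0 may be assumed to attain its norm at some y0; then
   the point (x0, y0) and the functional (0, g0) form a state pair, to which the
   weak BPBp-nu applies.  It yields an operator S on Z and a state pair with
   point (x1, y1) and functional (f, g).  As the X-component of S is small,
   f = 0; as the restriction of S to Y is small, ||x1|| = 1.  If phi is a
   norming functional at x1, then x |-> S (x, phi(x) y1) followed by the
   projection to Y has norm nu(S), because n(Y) = 1, and attains it at x1 and g;
   it remains to divide it by nu(S). *)

Set Implicit Arguments.
Unset Strict Implicit.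
Unset Printing Implicit Defensive.

Import Order.TTheory GRing.Theory Num.Theory.
Import numFieldNormedType.Exports.
Local Open Scope classical_set_scope.
Local Open Scope ring_scope.

(** * Real and complex scalars, with the real line embedded in either field *)

Definition real_scalar (R : realType) (k : scalar_kind) : R -> scalars R k :=
  match k with
  | RealScalars => fun r => r
  | ComplexScalars => fun r => real_complex R r
  end.

Section Scalars.
Context {R : realType} {k : scalar_kind}.
Local Notation K := (scalars R k).
Local Notation re := (@scalar_re R k).
Local Notation emb := (@real_scalar R k).

Lemma real_scalarD (r s : R) : emb (r + s) = emb r + emb s.
Proof. by rewrite /real_scalar; case: k => //; rewrite rmorphD. Qed.

Lemma real_scalarM (r s : R) : emb (r * s) = emb r * emb s.
Proof. by rewrite /real_scalar; case: k => //; rewrite rmorphM. Qed.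

Lemma real_scalar1 : emb 1 = 1.
Proof. by rewrite /real_scalar; case: k. Qed.

Lemma real_scalar_le (r s : R) : (emb r <= emb s) = (r <= s).
Proof. by rewrite /real_scalar; case: k => //=; rewrite lecR. Qed.

Lemma scalar_reK (r : R) : re (emb r) = r.
Proof. by rewrite /real_scalar /scalar_re; case: k. Qed.

Lemma scalar_reD (z w : K) : re (z + w) = re z + re w.
Proof. by move: z w; rewrite /scalar_re; case: k => //= -[? ?] []. Qed.

Lemma scalar_re_realM (r : R) (z : K) : re (emb r * z) = r * re z.
Proof.
move: z; rewrite /scalar_re /real_scalar; case: k => //= -[a b] /=.
by rewrite mul0r subr0.
Qed.

Lemma real_scalar_norm (z : K) : emb (re `|z|) = `|z|.
Proof. by move: z; rewrite /scalar_re /real_scalar; case: k. Qed.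

Lemma scalar_re_le_norm (z : K) : re z <= re `|z|.
Proof.
move: z; rewrite /scalar_re; case: k => /= [z|[a b]]; first exact: ler_norm.
by rewrite /= (le_trans (ler_norm _))// -sqrtr_sqr ler_wsqrtr// lerDl sqr_ge0.
Qed.

(** In the complex case squaring gives [a ^+ 2 + b ^+ 2 <= a ^+ 2], so the imaginary part is
    zero. *)
Lemma scalar_re_norm_eq (z : K) : re `|z| <= re z -> z = `|z|.
Proof.
move: z; rewrite /scalar_re; case: k => /= [z|[a b]] /=.
  by move=> h; apply/eqP; rewrite eq_le ler_norm.
move=> h; have a0 : 0 <= a by rewrite (le_trans _ h)// sqrtr_ge0.
have : a ^+ 2 + b ^+ 2 <= a ^+ 2.
  by rewrite -[leLHS]sqr_sqrtr ?addr_ge0 ?sqr_ge0// ler_sqr ?nnegrE ?sqrtr_ge0.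
rewrite gerDl => b0; have /eqP b2 : b ^+ 2 == 0 by rewrite eq_le b0 sqr_ge0.
move: b2 => /eqP; rewrite sqrf_eq0 => /eqP ->.
by rewrite normc_def /= expr0n /= addr0 sqrtr_sqr ger0_norm.
Qed.

Lemma real_scalar0 : emb 0 = 0.
Proof. by rewrite /real_scalar; case: k. Qed.

Lemma real_scalarN (r : R) : emb (- r) = - emb r.
Proof.
by apply/eqP; rewrite -addr_eq0 -real_scalarD addNr real_scalar0.
Qed.

Lemma real_scalar_lt (r s : R) : (emb r < emb s) = (r < s).
Proof.
rewrite !lt_neqAle real_scalar_le; congr (~~ _ && _).
by apply/eqP/eqP => [/(congr1 (@scalar_re R k))|->//]; rewrite !scalar_reK.
Qed.

Lemma normr_real_scalar (r : R) : `|emb r| = emb `|r|.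
Proof.
have [r0|r0] := leP 0 r.
  by rewrite !ger0_norm// -real_scalar0 real_scalar_le.
rewrite !ltr0_norm ?real_scalarN//.
by rewrite -real_scalar0 real_scalar_lt.
Qed.

Lemma scalar_re_norm_real (r : R) : scalar_re `|emb r| = `|r|.
Proof. by rewrite normr_real_scalar scalar_reK. Qed.

Lemma scalar_reN (z : K) : scalar_re (- z) = - scalar_re z.
Proof.
by apply/eqP; rewrite -addr_eq0 -scalar_reD addNr -real_scalar0 scalar_reK.
Qed.

End Scalars.

(** The existential form lets each operator below be given by a formula and afterwards be known only
    through an equation of functions. *)
Lemma exists_linear (K : pzRingType) (U V : lmodType K) (f : U -> V) :
  linear f -> exists g : {linear U -> V}, g = f :> (U -> V).
Proof.
move=> flin.
pose m := GRing.isLinear.Build K U V *:%R f flin.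
pose g : {linear U -> V} := HB.pack f m.
by exists g.
Qed.

Lemma norm_phase (K : numFieldType) (a : K) :
  exists2 u : K, `|u| = 1 & u * a = `|a|.
Proof.
have [->|a0] := eqVneq a 0; first by exists 1; rewrite ?normr1// mulr0 normr0.
have na : `|a| != 0 by rewrite normr_eq0.
exists (`|a| / a); last by rewrite divfK.
by rewrite normrM normrV ?unitfE// normr_id divff.
Qed.

(** The factor [u] undoes the phase of [b] and then applies that of [a]. *)
Lemma norm_align (K : numFieldType) (a b : K) :
  exists2 u : K, `|u| = 1 & `|a + u * b| = `|a| + `|b|.
Proof.
have [v v1 vb] := norm_phase b; have [w w1 wa] := norm_phase a.
have w0 : w != 0 by rewrite -normr_eq0 w1 oner_eq0.
have wV1 : `|w^-1| = 1 by rewrite normfV w1 invr1.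
have wE : a = w^-1 * `|a| by rewrite -wa mulKf.
exists (w^-1 * v); first by rewrite normrM wV1 v1 mulr1.
rewrite -mulrA vb [X in X + _]wE -mulrDr normrM wV1 mul1r.
by rewrite ger0_norm// addr_ge0.
Qed.

(** * Real-valued norms and operator norms *)

Section Norms.
Context {R : realType} {k : scalar_kind}.
Local Notation K := (scalars R k).
Local Notation emb := (@real_scalar R k).

Section OneSpace.
Context {V : normedModType K}.
Implicit Types (u v : V).

Lemma normr_rnorm v : `|v| = emb (rnorm v).
Proof.
by rewrite /rnorm -{1}(normr_id v) -real_scalar_norm normr_id.
Qed.

Lemma rnorm_ge0 v : 0 <= rnorm v.
Proof. by rewrite -(@real_scalar_le R k) -normr_rnorm real_scalar0. Qed.

Lemma rnorm0 : rnorm (0 : V) = 0.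
Proof. by rewrite /rnorm normr0 -real_scalar0 scalar_reK. Qed.

Lemma rnorm0_eq0 v : rnorm v = 0 -> v = 0.
Proof. by move=> v0; apply/normr0_eq0; rewrite normr_rnorm v0 real_scalar0. Qed.

Lemma rnormD u v : rnorm (u + v) <= rnorm u + rnorm v.
Proof.
by rewrite -(@real_scalar_le R k) real_scalarD -!normr_rnorm ler_normD.
Qed.

Lemma rnormN v : rnorm (- v) = rnorm v.
Proof. by rewrite /rnorm normrN. Qed.

Lemma rnormBC u v : rnorm (u - v) = rnorm (v - u).
Proof. by rewrite -rnormN opprB. Qed.

Lemma rnormB u v : rnorm (u - v) <= rnorm u + rnorm v.
Proof. by rewrite -(rnormN v) rnormD. Qed.

Lemma rnormZ (a : K) v : rnorm (a *: v) = scalar_re `|a| * rnorm v.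
Proof.
by rewrite {1}/rnorm normrZ -(real_scalar_norm a) scalar_re_realM scalar_reK.
Qed.

Lemma rnormZr (r : R) v : rnorm (emb r *: v) = `|r| * rnorm v.
Proof. by rewrite rnormZ scalar_re_norm_real. Qed.

Lemma rnormZ1 (u : K) v : `|u| = 1 -> rnorm (u *: v) = rnorm v.
Proof. by move=> u1; rewrite rnormZ u1 -real_scalar1 scalar_reK mul1r. Qed.

Lemma rnorm_gt0 v : v != 0 -> 0 < rnorm v.
Proof.
move=> v0; rewrite lt_neqAle rnorm_ge0 andbT eq_sym.
by apply: contra v0 => /eqP/rnorm0_eq0 ->.
Qed.

End OneSpace.

Lemma rnorm_scalar_real (r : R) : rnorm (emb r : K^o) = `|r|.
Proof. exact: scalar_re_norm_real. Qed.

Lemma rnorm_scalar1 : rnorm (1 : K^o) = 1.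
Proof. by rewrite -real_scalar1 rnorm_scalar_real normr1. Qed.

Lemma scalar_re_le_rnorm (a : K^o) : scalar_re a <= rnorm a.
Proof. exact: scalar_re_le_norm. Qed.

Lemma eq_real_scalar (a : K^o) (r : R) :
  rnorm a <= r -> r <= scalar_re a -> a = emb r.
Proof.
move=> ar ra; have aE := scalar_re_norm_eq (le_trans ar ra).
rewrite aE -real_scalar_norm; congr emb; apply/eqP.
by rewrite eq_le ar (le_trans ra)// scalar_re_le_norm.
Qed.

Lemma rnorm_align (a b : K^o) :
  exists2 u : K, `|u| = 1 & rnorm (a + u *: b) = rnorm a + rnorm b.
Proof.
have [u u1 ab] := norm_align (a : K) (b : K).
by exists u; rewrite // {1}/rnorm [X in scalar_re X]ab scalar_reD.
Qed.

Lemma rnorm_pair (X Y : normedModType K) (z : X * Y) :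
  rnorm z = Num.max (rnorm z.1) (rnorm z.2).
Proof.
rewrite {1}/rnorm prod_normE /= !normr_rnorm.
have [h|h] := leP (rnorm z.1) (rnorm z.2).
  by rewrite max_r ?real_scalar_le// scalar_reK.
by rewrite max_l ?real_scalar_le ?(ltW h)// scalar_reK.
Qed.

Section Operators.
Context {X Y : normedModType K}.

Lemma opnorm_le_bound (T : X -> Y) (M : R) :
  T 0 = 0 -> (forall x, rnorm x <= 1 -> rnorm (T x) <= M) -> opnorm T <= M.
Proof.
move=> T0 TM; apply: ge_sup => [|_ [x /= x1 <-]]; last exact: TM.
by exists 0, 0; rewrite //= ?T0 ?rnorm0.
Qed.

(** Rescaling a nonzero [x] to norm 1 turns the bound on the unit ball into the bound
    [M * rnorm x]. *)
Lemma bounded_continuous (T : {linear X -> Y}) (M : R) :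
  (forall x, rnorm x <= 1 -> rnorm (T x) <= M) -> continuous T.
Proof.
move=> TM; apply: bounded_linear_continuous.
apply/linear_boundedP.
have M0 : 0 <= M by rewrite (le_trans _ (TM 0 _)) ?rnorm_ge0 ?rnorm0.
near=> r => x.
apply: (@le_trans _ _ (emb M * `|x|)); last first.
  rewrite ler_wpM2r//; near: r; apply: nbhs_pinfty_ge.
  by rewrite realE -real_scalar0 real_scalar_le M0.
rewrite !normr_rnorm -real_scalarM real_scalar_le.
have [->|x0] := eqVneq x 0; first by rewrite linear0 !rnorm0 mulr0.
have n0 := rnorm_gt0 x0.
have := TM (emb (rnorm x)^-1 *: x).
rewrite linearZ /= !rnormZr ger0_norm ?invr_ge0 ?rnorm_ge0// mulVf ?gt_eqF//.
by move=> /(_ (lexx _)); rewrite ler_pdivrMl// mulrC.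
Unshelve. all: by end_near. Qed.

Lemma continuous_bounded (T : {linear X -> Y}) : continuous T ->
  exists M, forall x, rnorm (T x) <= M * rnorm x.
Proof.
move=> /linear_bounded_continuous/linear_boundedP/pinfty_ex_gt0[M M0 TM].
exists (scalar_re M) => x; have := TM x.
by rewrite !normr_rnorm -[M]ger0_norm ?(ltW M0)// -{1}real_scalar_norm
  -real_scalarM real_scalar_le.
Qed.

Lemma opnorm_has_sup (T : {linear X -> Y}) : continuous T ->
  has_sup [set rnorm (T x) | x in [set x | rnorm x <= 1]].
Proof.
move=> /continuous_bounded[M TM]; split.
  by exists 0, 0; rewrite //= ?linear0 ?rnorm0.
exists `|M| => _ [x /= x1 <-]; rewrite (le_trans (TM x))//.
rewrite (le_trans (ler_norm _))// normrM (ger0_norm (rnorm_ge0 _)).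
by rewrite ler_piMr.
Qed.

Lemma rnorm_le_opnorm (T : {linear X -> Y}) x :
  continuous T -> rnorm (T x) <= opnorm T * rnorm x.
Proof.
move=> Tc.
have [->|x0] := eqVneq x 0; first by rewrite linear0 !rnorm0 mulr0.
have n0 := rnorm_gt0 x0.
suff : rnorm (T (emb (rnorm x)^-1 *: x)) <= opnorm T.
  rewrite linearZ /= rnormZr ger0_norm ?invr_ge0 ?rnorm_ge0//.
  by rewrite ler_pdivrMl// mulrC.
apply: ub_le_sup; first exact: (opnorm_has_sup Tc).2.
exists (emb (rnorm x)^-1 *: x) => //=.
by rewrite rnormZr ger0_norm ?invr_ge0 ?rnorm_ge0// mulVf ?gt_eqF.
Qed.

Lemma rnorm_le_opnorm1 (T : {linear X -> Y}) x :
  continuous T -> rnorm x <= 1 -> rnorm (T x) <= opnorm T.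
Proof.
move=> Tc x1; apply: ub_le_sup; first exact: (opnorm_has_sup Tc).2.
by exists x.
Qed.

Lemma opnorm_ge0 (T : {linear X -> Y}) : continuous T -> 0 <= opnorm T.
Proof.
by move=> Tc; rewrite -(@rnorm0 Y) -(linear0 T) rnorm_le_opnorm1// rnorm0.
Qed.

End Operators.

(** Upper bounds suffice for a state pair: [1 = rnorm (f x) <= opnorm f * rnorm x] forces both norms
    to be 1. *)
Lemma state_pairs_norm_le1 (V : normedModType K) (x : V)
    (f : {linear V -> K^o}) :
  rnorm x <= 1 -> (forall v, rnorm v <= 1 -> rnorm (f v) <= 1) -> f x = 1 ->
  state_pairs (x, f).
Proof.
move=> x1 f1 fx; have fc := bounded_continuous f1.
have fN : opnorm f = 1.
  apply/eqP; rewrite eq_le opnorm_le_bound ?linear0//=.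
  by rewrite -rnorm_scalar1 -fx rnorm_le_opnorm1.
split=> //=; rewrite /unit_sphere /=; apply/eqP; rewrite eq_le x1/=.
by have := rnorm_le_opnorm x fc; rewrite fN mul1r fx rnorm_scalar1.
Qed.

(** * Numerical radius and numerical index *)

Section NumericalRadius.
Context {X : normedModType K}.

Lemma numerical_radius_ge (T : {linear X -> X}) (p : X * {linear X -> K^o}) :
  continuous T -> state_pairs p -> rnorm (p.2 (T p.1)) <= numerical_radius T.
Proof.
move=> Tc pX; apply: ub_le_sup; last by exists p.
exists (opnorm T) => _ [[x f] [/= x1 [fc f1] _] <-] /=.
rewrite (le_trans (rnorm_le_opnorm _ fc))// f1 mul1r rnorm_le_opnorm1//.
by rewrite x1.
Qed.

(** The hypothesis [0 <= M] covers a space without state pairs, where the supremum of the empty set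
    is 0. *)
Lemma numerical_radius_le (T : X -> X) (M : R) : 0 <= M ->
  (forall p, @state_pairs R k X p -> rnorm (p.2 (T p.1)) <= M) ->
  numerical_radius T <= M.
Proof.
move=> M0 TM; rewrite /numerical_radius; set S := [set _ | _ in _].
have [->|/set0P[a Sa]] := eqVneq S set0.
  by rewrite sup0.
apply: ge_sup; first by exists a.
by move=> _ [p pX <-]; exact: TM.
Qed.

Lemma numerical_radius_ge0 (T : X -> X) : 0 <= numerical_radius T.
Proof.
rewrite /numerical_radius; set S := [set _ | _ in _].
(* Here [T] is any map, so the set may be unbounded; [sup] then takes its default value 0. *)
have [Ssup|Snosup] := pselect (has_sup S); last by rewrite sup_out.
have [a Sa] := Ssup.1; have := sup_upper_bound Ssup Sa.
by case: Sa => p _ <-; apply: le_trans; exact: rnorm_ge0.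
Qed.

(** The numerical index speaks of operators of norm 1 only, so a nonzero [T] is divided by its norm
    [c] and the inequality is scaled back. *)
Lemma opnorm_le_numerical_radius (T : {linear X -> X}) :
  numerical_index X = 1 -> continuous T -> opnorm T <= numerical_radius T.
Proof.
move=> nX Tc; have := opnorm_ge0 Tc; rewrite le_eqVlt => /predU1P[<-|c0].
  exact: numerical_radius_ge0.
set c := opnorm T in c0 *.
have eZ x : rnorm (emb c^-1 *: T x) = c^-1 * rnorm (T x).
  by rewrite rnormZr ger0_norm// invr_ge0 ltW.
have [|U UE] := @exists_linear _ X X (fun x => emb c^-1 *: T x).
  by move=> a x y; rewrite linearP scalerDr !scalerA mulrC.
have Uc : continuous U.
  apply: (@bounded_continuous _ _ _ 1) => x x1.
  by rewrite UE eZ ler_pdivrMl// mulr1 rnorm_le_opnorm1.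
have Un : opnorm U = 1.
  apply/eqP; rewrite eq_le; apply/andP; split.
    apply: opnorm_le_bound; first by rewrite linear0.
    by move=> x x1; rewrite UE eZ ler_pdivrMl// mulr1 rnorm_le_opnorm1.
  rewrite -(ler_pM2l c0) mulr1.
  apply: opnorm_le_bound; first by rewrite linear0.
  move=> x x1; rewrite -ler_pdivrMl// -eZ.
  by have := rnorm_le_opnorm1 Uc x1; rewrite UE.
have : 1 <= numerical_radius U.
  rewrite -nX; apply: ge_inf; last by exists U.
  by exists 0 => _ [S _ <-]; exact: numerical_radius_ge0.
rewrite -(ler_pM2l c0) mulr1 => /le_trans; apply.
rewrite mulrC -ler_pdivlMr//; apply: numerical_radius_le.
  by rewrite divr_ge0 ?numerical_radius_ge0// ltW.
move=> p pX; rewrite UE linearZ /= rnormZr ger0_norm ?invr_ge0 ?(ltW c0)//.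
by rewrite [leLHS]mulrC ler_pM2r ?invr_gt0// numerical_radius_ge.
Qed.

End NumericalRadius.
End Norms.

(** * The Hahn-Banach theorem over the reals *)

Section HahnBanach.
Context {R : realType} {V : lmodType R}.
Implicit Types (p q : V -> R) (x y v w : V) (C : V -> R -> Prop).

Definition sublinear q :=
  (forall x y, q (x + y) <= q x + q y) /\
  (forall (t : R) x, 0 <= t -> q (t *: x) = t * q x).

(** A convex cone in [V * R], given by membership; [C w a] will stand for the demand that a
    functional take at least the value [a] at [w]. *)
Definition convex_cone C :=
  [/\ C 0 0, forall v w a b, C v a -> C w b -> C (v + w) (a + b) &
      forall (t : R) v a, 0 <= t -> C v a -> C (t *: v) (t * a)].

Lemma sublinear0 q : sublinear q -> q 0 = 0.
Proof. by case=> _ /(_ 0 0 (lexx _)); rewrite scaler0 mul0r. Qed.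

Lemma sublinear_geN q x : sublinear q -> - q (- x) <= q x.
Proof.
move=> qs; rewrite lerNl -subr_ge0 opprK -(sublinear0 qs) -(subrr x).
by rewrite addrC; exact: qs.1.
Qed.

(** Serves two infima, one indexed by a cone and one by a chain; in both, sums and multiples are
    handled by passing to another index [l]. *)
Lemma sublinear_inf (I : Type) (S : set I) (F : I -> V -> R) :
  S !=set0 ->
  (forall x, has_lbound [set F i x | i in S]) ->
  (forall i j x y, S i -> S j ->
    exists2 l, S l & F l (x + y) <= F i x + F j y) ->
  (forall i (t : R) x, S i -> 0 < t ->
    exists2 l, S l & F l (t *: x) <= t * F i x) ->
  sublinear (fun x => inf [set F i x | i in S]).
Proof.
move=> [i0 Si0] lb FD FZ; set q := fun x => _.
have qle i x : S i -> q x <= F i x.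
  by move=> Si; apply: ge_inf; [exact: lb|exists i].
have leq x a : (forall i, S i -> a <= F i x) -> a <= q x.
  move=> h; apply: lb_le_inf; first by exists (F i0 x), i0.
  by move=> _ [i Si <-]; exact: h.
rewrite -/q; clearbody q.
have qZ (t : R) x : 0 < t -> q (t *: x) <= t * q x.
  move=> t0; rewrite -ler_pdivrMl//; apply: leq => i Si.
  rewrite ler_pdivrMl//; have [l Sl /(le_trans _)] := FZ i t x Si t0.
  by apply; exact: qle.
split=> [x y|t x].
  rewrite -lerBlDl; apply: (leq y (q (x + y) - q x)) => j Sj.
  rewrite lerBlDl -lerBlDr; apply: (leq x (q (x + y) - F j y)) => i Si.
  rewrite lerBlDr.
  have [l Sl /(le_trans _)] := FD i j x y Si Sj.
  by apply; exact: qle.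
(* The reverse inequality is the one for [s^-1] at the point [s *: v]. *)
have qZ' s v : 0 < s -> q (s *: v) = s * q v.
  move=> s0; apply/eqP; rewrite eq_le qZ//= -ler_pdivlMl//.
  have s0' : 0 < s^-1 by rewrite invr_gt0.
  by have := qZ s^-1 (s *: v) s0'; rewrite scalerA mulVf ?gt_eqF// scale1r.
rewrite le_eqVlt => /predU1P[<-|/qZ' //].
(* The case [t = 0]: from [q 0 = 2 * q 0] it follows that [q 0] vanishes. *)
have := qZ' 2 0 (ltr0n _ 2); rewrite scaler0 scale0r mul0r.
by rewrite mulr_natl mulr2n; lra.
Qed.

(** Take for [q' x] the infimum of [q (x + w) - a] over the cone. It is finite because
    [a <= q w <= q (x + w) + q (- x)]; the element [(0, 0)] gives [q' <= q], and [(w, a)] gives the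
    bound at [- w]. *)
Lemma sublinear_lower q C : sublinear q -> convex_cone C ->
  (forall w a, C w a -> a <= q w) ->
  exists q', [/\ sublinear q', forall x, q' x <= q x &
                 forall w a, C w a -> q' (- w) <= - a].
Proof.
move=> qs [C0 CD CZ] Cq.
pose F (i : V * R) v := q (v + i.1) - i.2.
pose S : set (V * R) := [set i | C i.1 i.2].
have lb x : has_lbound [set F i x | i in S].
  exists (- q (- x)) => _ [[w a] /= /Cq Cwa <-]; rewrite /F/=.
  rewrite lerBrDr (le_trans _ (_ : - q (- x) + q w <= _)) ?lerD2l//.
  by rewrite addrC lerBlDr (le_trans _ (qs.1 _ _))// addrAC subrr add0r.
exists (fun x => inf [set F i x | i in S]); split.
- apply: sublinear_inf => //; first by exists (0, 0).
  + move=> [v a] [w b] x y Sv Sw; exists (v + w, a + b); first exact: CD.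
    by rewrite /F /= [leRHS]addrACA -opprD lerD2r addrACA qs.1.
  + move=> [v a] t x Sv t0; exists (t *: v, t * a).
      exact: (CZ _ _ _ (ltW t0)).
    by rewrite /F /= -scalerDr qs.2 ?(ltW t0)// mulrBr.
- move=> x; rewrite (_ : q x = F (0, 0) x); last by rewrite /F /= addr0 subr0.
  by apply: ge_inf; [exact: lb|exists (0, 0)].
- move=> w a Cwa; rewrite (_ : - a = F (w, a) (- w)); last first.
    by rewrite /F /= addNr (sublinear0 qs) add0r.
  by apply: ge_inf; [exact: lb|exists (w, a)].
Qed.

(** Zorn's lemma for the reversed pointwise order. The infimum of a chain is finite, since each
    member is at least [- p (- x)] at [x], and subadditive, since any two members are comparable. *)
Lemma sublinear_minimal p : sublinear p ->
  exists2 q, sublinear q /\ (forall x, q x <= p x) &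
  forall q', sublinear q' -> (forall x, q' x <= q x) -> q' = q.
Proof.
move=> ps; pose P q := sublinear q /\ forall x, q x <= p x.
pose T := {q : V -> R | P q}.
pose r (s t : T) : bool := `[< forall x, sval t x <= sval s x >].
have [|||A Atot|m mmin] := @Zorn T r.
- by move=> t; apply/asboolP.
- move=> a b c /asboolP ab /asboolP bc; apply/asboolP => x.
  exact: le_trans (bc x) (ab x).
- move=> [s sP] [t tP] /asboolP st /asboolP ts.
  have : s = t by apply/funext => x; apply/eqP; rewrite eq_le ts st.
  move=> st'; move: tP {st ts}; rewrite -st' => sP'.
  by rewrite (Prop_irrelevance sP sP').
(* An empty chain is bounded by [p] itself. *)
- have [[s0 As0]|A0] := pselect (A !=set0); last first.
    have pp : P p by [].
    by exists (exist P p pp) => s As; exfalso; apply: A0; exists s.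
  have lb x : has_lbound [set sval s x | s in A].
    exists (- p (- x)) => _ [[s [ss sp]] /= _ <-].
    by rewrite (le_trans _ (sublinear_geN _ ss))// lerN2.
  have qp : P (fun x => inf [set sval s x | s in A]).
    split=> /=.
      apply: sublinear_inf => //; first by exists s0.
        move=> s t x y As At; case: (svalP s) (svalP t) => -[sD _] _ [[tD _] _].
        have [/asboolP st|/asboolP ts] := Atot s t As At.
          by exists t => //; rewrite (le_trans (tD _ _))// lerD2r.
        by exists s => //; rewrite (le_trans (sD _ _))// lerD2l.
      move=> s t x As t0; exists s => //.
      by case: (svalP s) => -[_ sZ] _; rewrite sZ ?(ltW t0).
    move=> x; apply: le_trans (_ : sval s0 x <= _); last by case: (svalP s0).
    by apply: ge_inf; [exact: lb|exists s0].
  exists (exist P _ qp) => s As; apply/asboolP => x /=.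
  by apply: ge_inf; [exact: lb|exists s].
- exists (sval m); first exact: (svalP m).
  move=> q' q's q'm; have [ms mp] := svalP m.
  have q'p : P q'.
    by split=> // x; exact: le_trans (q'm x) (mp x).
  have := mmin (exist _ q' q'p); rewrite /r /= => /(_ _)/(congr1 sval) /= <- //.
  by apply/asboolP.
Qed.

(* The Hahn-Banach theorem in its Mazur-Orlicz form.  A minimal sublinear
   functional h is linear: lowering it along the ray of y as in
   [sublinear_lower] cannot change it, so h (- y) <= - h y. *)
Theorem linear_between_cone p C : sublinear p -> convex_cone C ->
  (forall w a, C w a -> a <= p w) ->
  exists h : V -> R, [/\ forall x y, h (x + y) = h x + h y,
    forall (t : R) x, h (t *: x) = t * h x,
    forall x, h x <= p x & forall w a, C w a -> a <= h w].
Proof.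
(* Every linear functional below [q0] meets the demands of [C], so it is enough to minimise below
   [q0]. *)
move=> ps Cc Cp; have [q0 [q0s q0p q0C]] := sublinear_lower ps Cc Cp.
have [h [hs hq0] hmin] := sublinear_minimal q0s.
have hN y : h (- y) = - h y.
  apply/eqP; rewrite eq_le [X in _ && X]lerNl; apply/andP; split; last first.
    by have := sublinear_geN (- y) hs; rewrite opprK lerNl.
  have [||q' [q's q'h q'C]] :=
    @sublinear_lower h
      (fun w a => exists t : R, [/\ 0 <= t, w = t *: y & a = t * h y]) hs.
  - split; first by exists 0; rewrite scale0r mul0r.
      move=> _ _ _ _ [t [t0 -> ->]] [s [s0 -> ->]].
      by exists (t + s); rewrite addr_ge0// scalerDl mulrDl.
    move=> s _ _ s0 [t [t0 -> ->]].
    by exists (s * t); rewrite mulr_ge0// scalerA mulrA.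
  - by move=> _ _ [t [t0 -> ->]]; rewrite hs.2.
  - rewrite -(hmin q' q's q'h); apply: q'C.
    by exists 1; rewrite ler01 scale1r mul1r (hmin q' q's q'h).
(* Superadditivity: [h x <= h (x + y) + h (- y)], and [h] is odd. *)
have hD x y : h (x + y) = h x + h y.
  apply/eqP; rewrite eq_le hs.1/= -lerBrDr -hN.
  by rewrite -{1}(addrK y x) hs.1.
exists h; split=> //.
- move=> t x; have [t0|t0] := leP 0 t; first exact: hs.2.
  by rewrite -[t]opprK scaleNr hN hs.2 ?mulNr// oppr_ge0 ltW.
- by move=> x; exact: le_trans (hq0 x) (q0p x).
- by move=> w a Cwa; rewrite -lerN2 -hN (le_trans (hq0 _))// q0C.
Qed.

End HahnBanach.

(** * From real-linear to [K]-linear functionals *)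

Section RealPart.
Context {R : realType} {k : scalar_kind}.
Local Notation K := (scalars R k).
Local Notation emb := (@real_scalar R k).

(** A separate name for [V], which can carry a module structure over [R] beside the given one over
    [K]. *)
Definition realification (V : lmodType K) : Type := V.

HB.instance Definition _ (V : lmodType K) :=
  GRing.Zmodule.on (realification V).

Fact realification_scalerA (V : lmodType K) (r s : R) (v : V) :
  emb r *: (emb s *: v) = emb (r * s) *: v.
Proof. by rewrite scalerA real_scalarM. Qed.

Fact realification_scale1r (V : lmodType K) :
  left_id 1 (fun r (v : V) => emb r *: v).
Proof. by move=> v; rewrite real_scalar1 scale1r. Qed.

Fact realification_scalerDr (V : lmodType K) :
  right_distributive (fun r (v : V) => emb r *: v) +%R.
Proof. by move=> r u v; rewrite scalerDr. Qed.

Fact realification_scalerDl (V : lmodType K) (v : V) :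
  {morph (fun r => emb r *: v) : r s / r + s}.
Proof. by move=> r s; rewrite real_scalarD scalerDl. Qed.

HB.instance Definition _ (V : lmodType K) :=
  GRing.Zmodule_isLmodule.Build R (realification V)
    (@realification_scalerA V) (@realification_scale1r V)
    (@realification_scalerDr V) (@realification_scalerDl V).

End RealPart.

(** In the complex case [f x] is [h x - i h (i x)], the only complex-linear choice with real part
    [h]. *)
Lemma exists_linear_re (R : realType) (k : scalar_kind)
    (V : lmodType (scalars R k)) (h : V -> R) :
  (forall x y, h (x + y) = h x + h y) ->
  (forall (t : R) x, h (real_scalar k t *: x) = t * h x) ->
  exists f : {linear V -> (scalars R k)^o}, forall x, scalar_re (f x) = h x.
Proof.
case: k V h => /= V h hD hZ.
  have [|f fE] := @exists_linear _ V R^o h; last by exists f => x; rewrite fE.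
  by move=> a x y; rewrite hD hZ.
have hN x : h (- x) = - h x.
  have := hZ (-1) x; rewrite mulN1r => <-; congr h.
  by rewrite rmorphN rmorph1 scaleN1r.
have [|f fE] := @exists_linear _ V (R[i])^o
  (fun x => (h x +i* (- h ('i%C *: x)))%C); last by exists f => x; rewrite fE.
move=> [b c] x y.
have E z : (b +i* c)%C *: z = b%:C%C *: z + c%:C%C *: ('i%C *: z).
  rewrite scalerA -scalerDl; congr (_ *: _).
  apply/eqP; rewrite eq_complex /=.
  by rewrite !(mulr0, mul0r, mulr1, subr0, addr0, add0r) !eqxx.
rewrite scalerDr scalerA mulrC -scalerA !hD !E !hD !hZ scalerA -expr2 sqr_i.
rewrite scaleN1r hN; apply/eqP; rewrite eq_complex /=.
by apply/andP; split; apply/eqP; ring.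
Qed.

Section Functionals.
Context {R : realType} {k : scalar_kind}.
Local Notation K := (scalars R k).
Local Notation emb := (@real_scalar R k).

(** The real theorem is applied to [realification V], and its [h] becomes the real part of [f]. *)
Lemma functional_between_cone (V : lmodType K) (p : V -> R)
    (C : V -> R -> Prop) :
  (forall x y, p (x + y) <= p x + p y) ->
  (forall (t : R) x, 0 <= t -> p (emb t *: x) = t * p x) ->
  C 0 0 -> (forall v w a b, C v a -> C w b -> C (v + w) (a + b)) ->
  (forall (t : R) v a, 0 <= t -> C v a -> C (emb t *: v) (t * a)) ->
  (forall w a, C w a -> a <= p w) ->
  exists f : {linear V -> K^o}, (forall x, scalar_re (f x) <= p x) /\
    forall w a, C w a -> a <= scalar_re (f w).
Proof.
move=> pD pZ C0 CD CZ Cp.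
have [//|//|//|h [hD hZ hp hC]] :=
  @linear_between_cone R (realification V) p C.
have [f fE] := exists_linear_re (V := V) hD hZ.
by exists f; split=> [x|w a Cwa]; rewrite fE; [exact: hp|exact: hC].
Qed.

(** Some rotation [u] makes [f (u *: x)] equal to the modulus of [f x]; this turns bounds on real
    parts into bounds on norms. *)
Lemma rnorm_functional_le (V : lmodType K) (f : {linear V -> K^o}) x (M : R) :
  (forall u : K, `|u| = 1 -> scalar_re (f (u *: x)) <= M) -> rnorm (f x) <= M.
Proof.
have [u u1 fu] := norm_phase (f x : K).
by move=> /(_ u u1); rewrite linearZ /= [_ *: _]fu.
Qed.

(** The cone is the ray of [x], with the demand [rnorm x] at [x]; domination by the norm then leaves
    only equality there. *)
Lemma exists_norming (V : normedModType K) (x : V) :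
  exists2 f : {linear V -> K^o}, (forall v, rnorm (f v) <= rnorm v) &
    f x = emb (rnorm x).
Proof.
have pZ (t : R) (v : V) : 0 <= t -> rnorm (emb t *: v) = t * rnorm v.
  by move=> t0; rewrite rnormZr ger0_norm.
have [||||f [fle fx]] := @functional_between_cone V (@rnorm R k V)
  (fun w a => exists t : R, [/\ 0 <= t, w = emb t *: x & a = t * rnorm x])
  (@rnormD R k V) pZ.
- by exists 0; rewrite real_scalar0 scale0r mul0r.
- move=> _ _ _ _ [t [t0 -> ->]] [s [s0 -> ->]].
  by exists (t + s); rewrite addr_ge0// real_scalarD scalerDl mulrDl.
- move=> s _ _ s0 [t [t0 -> ->]].
  by exists (s * t); rewrite mulr_ge0// scalerA mulrA real_scalarM.
- by move=> _ _ [t [t0 -> ->]]; rewrite pZ.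
have fn v : rnorm (f v) <= rnorm v.
  apply: rnorm_functional_le => u u1.
  by rewrite (le_trans (fle _))// rnormZ1.
exists f => //; apply: eq_real_scalar; first exact: fn.
by apply: fx; exists 1; rewrite real_scalar1 scale1r mul1r.
Qed.

End Functionals.

(** * Ekeland's principle and the Bishop-Phelps theorem *)

Section BishopPhelps.
Context {R : realType} {k : scalar_kind}.
Local Notation K := (scalars R k).
Local Notation emb := (@real_scalar R k).

(** Completeness with radii in [R]; the passage is possible because a positive element of [K] is
    real. *)
Lemma rnorm_cauchy_limit (V : completeNormedModType K) (u : nat -> V) :
  (forall r : R, 0 < r ->
     exists N, forall n, (N <= n)%N -> rnorm (u n - u N) < r) ->
  exists l, forall r : R, 0 < r ->
    exists N, forall n, (N <= n)%N -> rnorm (l - u n) < r.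
Proof.
move=> uC.
have posK (e : K) : 0 < e -> exists2 r : R, 0 < r & e = emb r.
  move=> e0; have eE : emb (scalar_re e) = e.
    by rewrite -[e]gtr0_norm// real_scalar_norm.
  exists (scalar_re e) => //.
  by rewrite -(@real_scalar_lt R k) real_scalar0 eE.
have : cvg (u @ \oo).
  apply: cauchy_cvg; apply: cauchy_exP => _ /posK[r r0 ->].
  have [N uN] := uC r r0; exists (u N).
  exists N => // n /= Nn; rewrite -ball_normE /= normr_rnorm real_scalar_lt.
  by rewrite rnormBC uN.
move=> /cvg_ex[l ul]; exists l => r r0.
have er0 : 0 < emb r by rewrite -(@real_scalar0 R k) real_scalar_lt.
have /cvgrPdist_lt/(_ _ er0)[N _ uN] := ul.
by exists N => n Nn; have := uN n Nn; rewrite /= normr_rnorm real_scalar_lt.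
Qed.

(** Ekeland's variational principle for a Lipschitz function. The set [S u] holds the points reached
    from [u] with a gain of at least [e] per unit of distance; repeatedly moving to a nearly best
    point of [S u] converges to [l]. *)
Lemma ekeland_unit_ball (V : completeNormedModType K) (phi : V -> R) (M e : R) :
  (forall x y, phi x - phi y <= M * rnorm (x - y)) -> 0 < e ->
  exists2 l, rnorm l <= 1 &
    forall y, rnorm y <= 1 -> phi y - phi l <= e * rnorm (y - l).
Proof.
move=> phiM e0.
pose S u := [set v | rnorm v <= 1 /\ e * rnorm (v - u) <= phi v - phi u].
have Sxx u : rnorm u <= 1 -> S u u.
  by move=> u1; split; rewrite // !subrr rnorm0 mulr0.
have Strans u v w : S u v -> S v w -> S u w.
  move=> [v1 uv] [w1 vw]; split=> //.
  rewrite -(subrKA (phi v)) (le_trans _ (lerD vw uv))// -mulrDr ler_pM2l//.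
  by rewrite -(subrKA v w (- u)) rnormD.
have phiB v : rnorm v <= 1 -> phi v <= phi 0 + `|M|.
  move=> v1; rewrite -lerBlDl (le_trans (phiM _ _))// subr0.
  rewrite (le_trans (ler_norm _))// normrM (ger0_norm (rnorm_ge0 _)).
  by rewrite ler_piMr.
(* The point [v] gets at least half way from [phi u] to the supremum of [phi] on [S u]. The norm
   condition stands inside the existential so that [choice] gives a total map. *)
have stepP u : exists v, rnorm u <= 1 ->
    S u v /\ forall w, S u w -> phi w <= 2 * phi v - phi u.
  have [u1|] := pselect (rnorm u <= 1); last by exists u.
  have Ssup : has_sup [set phi v | v in S u].
    split; first by exists (phi u), u => //; exact: Sxx.
    by exists (phi 0 + `|M|) => _ [v [v1 _] <-]; exact: phiB.
  have Sle w : S u w -> phi w <= sup [set phi v | v in S u].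
    by move=> Sw; apply: sup_upper_bound => //; exists w.
  have := Sle u (Sxx u u1); rewrite le_eqVlt => /predU1P[phiu|ltu].
    exists u => _; split=> [|w /Sle]; first exact: Sxx.
    by rewrite -phiu => h; rewrite mulr_natl mulr2n addrK.
  have d0 : 0 < (sup [set phi v | v in S u] - phi u) / 2.
    by rewrite divr_gt0// subr_gt0.
  have [_ [v Sv <-] lv] := sup_adherent d0 Ssup.
  exists v => _; split=> // w /Sle; lra.
have [next nextP] := choice stepP.
pose u n := iter n next 0.
have u1 n : rnorm (u n) <= 1.
  elim: n => [|n IHn]; first by rewrite rnorm0 ler01.
  by have [[]] := nextP _ IHn.
have Su n m : (n <= m)%N -> S (u n) (u m).
  elim: m => [|m IHm]; first by rewrite leqn0 => /eqP ->; apply: Sxx.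
  rewrite leq_eqVlt => /predU1P[->|/IHm Snm]; first exact: Sxx.
  by apply: Strans Snm _; have [] := nextP _ (u1 m).
have phi_le n m : (n <= m)%N -> phi (u n) <= phi (u m).
  move=> /Su[_]; rewrite -(subr_ge0 (phi (u n))); apply: le_trans.
  by rewrite mulr_ge0 ?rnorm_ge0 ?ltW.
pose A := sup (range (phi \o u)).
have Asup : has_sup (range (phi \o u)).
  split; first by exists (phi (u 0)), 0.
  by exists (phi 0 + `|M|) => _ [n _ <-]; exact: phiB.
have leA n : phi (u n) <= A by apply: sup_upper_bound => //; exists n.
have nearA (r : R) : 0 < r ->
    exists N, forall n, (N <= n)%N -> A - r < phi (u n).
  move=> r0; have [_ [N _ <-] lN] := sup_adherent r0 Asup.
  by exists N => n /phi_le; exact: lt_le_trans.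
(* Cauchy, because distances are bounded by gains of [phi], which increases along [u] and stays
   below [A]. *)
have [r r0|l ul] := @rnorm_cauchy_limit V u.
  have [N uN] := nearA (e * r) (mulr_gt0 e0 r0).
  exists N => n Nn; rewrite -(ltr_pM2l e0).
  have [_ /le_lt_trans] := Su _ _ Nn; apply.
  by rewrite ltrBlDl -ltrBlDr (le_lt_trans _ (uN N _))// lerD2r.
have lim_u (r : R) n : 0 < r -> exists2 m, (n <= m)%N & rnorm (l - u m) < r.
  move=> r0; have [N uN] := ul r r0; exists (maxn n N); first exact: leq_maxl.
  by apply: uN; exact: leq_maxr.
have l1 : rnorm l <= 1.
  apply/ler_addgt0Pr => r r0; have [m _ /ltW lm] := lim_u r 0 r0.
  by rewrite -(subrK (u m) l) addrC (le_trans (rnormD _ _))// lerD.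
(* Continuity of [phi]; the divisor [|M| + 1] is positive even if [M] is 0. *)
have leAl : A <= phi l.
  apply: ge_sup; first exact: Asup.1.
  move=> _ [n _ <-] /=; apply/ler_addgt0Pr => r r0.
  have M0 : 0 < `|M| + 1 by rewrite ltr_wpDl.
  have [m nm lm] := lim_u (r / (`|M| + 1)) n (divr_gt0 r0 M0).
  rewrite (le_trans (phi_le _ _ nm))// -lerBlDl (le_trans (phiM _ _))//.
  rewrite rnormBC; apply: (@le_trans _ _ ((`|M| + 1) * rnorm (l - u m))).
    by rewrite ler_wpM2r ?rnorm_ge0// (le_trans (ler_norm _))// lerDl.
  by rewrite mulrC -ler_pdivlMr// ltW.
have Sl n : S (u n) l.
  split=> //; apply/ler_addgt0Pr => r r0.
  have [m nm lm] := lim_u (r / e) n (divr_gt0 r0 e0).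
  have [_ unm] := Su _ _ nm.
  have : e * rnorm (l - u n) <= e * rnorm (l - u m) + e * rnorm (u m - u n).
    by rewrite -mulrDr ler_pM2l// -(subrKA (u m) l (- u n)) rnormD.
  move: lm; rewrite ltr_pdivlMr// mulrC; have := leA m; lra.
exists l => // y y1; rewrite leNgt; apply/negP => ly.
have Sly : S l y by split=> //; exact: ltW.
(* A better [y] would lie in every [S (u n)], and the half-way choice bounds [phi y] by
   [2 * phi (u N.+1) - phi (u N) < A + r]. *)
suff : phi y <= A.
  have : 0 <= e * rnorm (y - l) by rewrite mulr_ge0 ?rnorm_ge0 ?ltW.
  by move: ly leAl; lra.
apply/ler_addgt0Pr => r r0; have [N /(_ N (leqnn _)) uN] := nearA r r0.
have [_ /(_ y (Strans _ _ _ (Sl N) Sly))] := nextP _ (u1 N).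
by have := leA N.+1; rewrite /= -/(u N) in uN *; lra.
Qed.

(* The cone below is generated by the [v - y] for [v] in the unit ball, so that
   [h >= f] on it means that [f - h] attains its norm at [y]. *)
Theorem bishop_phelps (V : completeNormedModType K) (f : {linear V -> K^o})
    (e : R) :
  @dual_unit_sphere R k V f -> 0 < e < 1 ->
  exists (g : {linear V -> K^o}) (y : V),
    state_pairs (y, g) /\ opnorm (g \- f) <= 2 * e.
Proof.
move=> [fc f1] /andP[e0 e1].
have reB (z w : K) : scalar_re (z - w) = scalar_re z - scalar_re w.
  by rewrite scalar_reD scalar_reN.
have reM (F : {linear V -> K^o}) (t : R) v :
    scalar_re (F (emb t *: v)) = t * scalar_re (F v).
  by rewrite linearZ /= [_ *: _]/(_ * _) scalar_re_realM.
have [|y y1 yP] := @ekeland_unit_ball V (fun v => scalar_re (f v)) 1 e _ e0.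
  move=> v w; rewrite -reB -linearB mul1r (le_trans (scalar_re_le_norm _))//.
  by have := rnorm_le_opnorm (v - w) fc; rewrite f1 mul1r.
pose p (v : V) := e * rnorm v.
have pD v w : p (v + w) <= p v + p w by rewrite /p -mulrDr ler_pM2l// rnormD.
have pZ (t : R) v : 0 <= t -> p (emb t *: v) = t * p v.
  by move=> t0; rewrite /p rnormZr ger0_norm// mulrCA.
(* After division by [s], Ekeland's inequality at [y] is the domination required of this cone; [h]
   is then bounded by [e] times the norm. *)
have [||||h [hp hC]] := @functional_between_cone R k V p (fun w a =>
  exists s v, [/\ rnorm v <= s, w = v - emb s *: y &
                  a = scalar_re (f v) - s * scalar_re (f y)]) pD pZ.
- exists 0, 0; split; rewrite ?rnorm0 ?real_scalar0 ?scale0r ?subrr//.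
  by rewrite linear0 -(@real_scalar0 R k) scalar_reK mul0r subrr.
- move=> _ _ _ _ [s [v [vs -> ->]]] [t [w [wt -> ->]]].
  exists (s + t), (v + w); split.
    exact: le_trans (rnormD _ _) (lerD vs wt).
    by rewrite real_scalarD scalerDl opprD addrACA.
  by rewrite linearD scalar_reD mulrDl opprD addrACA.
- move=> t _ _ t0 [s [v [vs -> ->]]]; exists (t * s), (emb t *: v); split.
  + by rewrite rnormZr ger0_norm// ler_wpM2l.
  + by rewrite real_scalarM -scalerA scalerBr.
  + by rewrite reM mulrBr mulrA.
- move=> _ _ [s [v [vs -> ->]]].
  have [s0|s0] := leP s 0.
    have v0 : v = 0.
      by apply: rnorm0_eq0; apply/eqP; rewrite eq_le rnorm_ge0 (le_trans vs).
    have -> : s = 0 by apply/eqP; rewrite eq_le s0 (le_trans (rnorm_ge0 v)).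
    rewrite v0 linear0 -(@real_scalar0 R k) scalar_reK mul0r subrr.
    by rewrite mulr_ge0 ?rnorm_ge0 ?ltW.
  have sV : s * s^-1 = 1 by rewrite mulfV ?gt_eqF.
  have vE : v = emb s *: (emb s^-1 *: v).
    by rewrite scalerA -real_scalarM sV real_scalar1 scale1r.
  rewrite vE reM -mulrBr -scalerBr pZ ?(ltW s0)// ler_pM2l// yP//.
  by rewrite rnormZr gtr0_norm ?invr_gt0// ler_pdivrMl// mulr1.
have hn v : rnorm (h v) <= e * rnorm v.
  by apply: rnorm_functional_le => u u1; rewrite (le_trans (hp _))// /p rnormZ1.
pose m := scalar_re (f y) - scalar_re (h y).
pose g : {linear V -> K^o} := f \- h.
have gm v : rnorm v <= 1 -> rnorm (g v) <= m.
  move=> v1; apply: rnorm_functional_le => u u1.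
  rewrite /g /= reB /m.
  have : scalar_re (f (u *: v)) - 1 * scalar_re (f y) <=
      scalar_re (h (u *: v - emb 1 *: y)).
    apply: hC; exists 1, (u *: v); split=> //.
    by rewrite rnormZ1.
  rewrite real_scalar1 scale1r linearB reB mul1r; lra.
have gy : g y = emb m by apply: eq_real_scalar; [exact: gm|rewrite /g /= reB].
(* The value [m] is the norm of [g], and it lies within [e] of 1 because [f] has norm 1 and [h] at
   most [e]. *)
have m1 : 1 <= m + e.
  rewrite -f1; apply: opnorm_le_bound; first by rewrite linear0.
  move=> v v1; rewrite -(subrK (h v) (f v)).
  rewrite (le_trans (rnormD _ _))// lerD ?gm//.
  by rewrite (le_trans (hn v))// ler_piMr// ltW.
have m0 : 0 < m by lra.
have m2 : m <= 1 + e.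
  rewrite -(ger0_norm (ltW m0)) -(@scalar_re_norm_real R k) -gy.
  rewrite (le_trans (rnormB _ _))// lerD//.
    by rewrite -f1 rnorm_le_opnorm1.
  by rewrite (le_trans (hn y))// ler_piMr// ltW.
have gc : continuous g by exact: bounded_continuous gm.
have gZ v : rnorm (emb m^-1 *: g v) = m^-1 * rnorm (g v).
  by rewrite rnormZr gtr0_norm// invr_gt0.
have [|G GE] := @exists_linear _ V K^o (fun x => emb m^-1 *: g x).
  by move=> a u v; rewrite linearP scalerDr !scalerA mulrC.
have G1 v : rnorm v <= 1 -> rnorm (G v) <= 1.
  by move=> v1; rewrite GE gZ ler_pdivrMl// mulr1 gm.
have Gy : G y = 1.
  have sE : emb m^-1 *: (emb m : K^o) = emb (m^-1 * m) by rewrite real_scalarM.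
  by rewrite GE gy sE mulVf ?gt_eqF// real_scalar1.
exists G, y; split; first exact: (state_pairs_norm_le1 y1 G1 Gy).
apply: opnorm_le_bound => [|v v1] /=.
  by rewrite (linear0 G) (linear0 f) subr0.
(* The bound [2 * e] is [e] for the rescaling, as [(m^-1 - 1) * m = 1 - m], plus [e] for [h]. *)
have -> : G v - f v = emb (m^-1 - 1) *: g v - h v.
  rewrite GE real_scalarD real_scalarN real_scalar1 scalerBl scale1r /g /=.
  by rewrite opprB addrA [RHS]addrAC addrK.
rewrite (le_trans (rnormB _ _))// rnormZr mulr_natl mulr2n lerD//; last first.
  by rewrite (le_trans (hn v))// ler_piMr// ltW.
apply: (@le_trans _ _ (`|m^-1 - 1| * m)); first by rewrite ler_wpM2l// gm.
rewrite -{2}(gtr0_norm m0) -normrM mulrBl mulVf ?gt_eqF// mul1r ler_norml.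
by apply/andP; split; lra.
Qed.

End BishopPhelps.

(** * State pairs and operators on the l_infty-sum *)

Section Sum.
Context {R : realType} {k : scalar_kind}.
Local Notation K := (scalars R k).
Local Notation emb := (@real_scalar R k).
Context {X Y : normedModType K}.

Lemma rnorm_fst (z : (X * Y)%type) : rnorm z.1 <= rnorm z.
Proof. by rewrite rnorm_pair le_max lexx. Qed.

Lemma rnorm_snd (z : (X * Y)%type) : rnorm z.2 <= rnorm z.
Proof. by rewrite rnorm_pair le_max lexx orbT. Qed.

Lemma rnorm_pair_le1 (x : X) (y : Y) :
  rnorm x <= 1 -> rnorm y <= 1 -> rnorm (x, y) <= 1.
Proof. by move=> x1 y1; rewrite rnorm_pair ge_max x1. Qed.

(** The functional sees the second coordinate only, so [x] may be any point of the unit ball; later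
    proofs rotate or move it. *)
Lemma state_pairs_snd (x : X) (y : Y) (g : {linear Y -> K^o}) :
  rnorm x <= 1 -> state_pairs (y, g) ->
  exists2 F : {linear (X * Y)%type -> K^o}, (forall z, F z = g z.2) &
    state_pairs ((x, y), F).
Proof.
move=> x1 [/= y1 [gc gN] gy].
have [|F FE] := @exists_linear _ (X * Y)%type K^o (fun z => g z.2).
  by move=> a u v /=; rewrite linearP.
exists F => [z|]; first by rewrite FE.
apply: state_pairs_norm_le1; [|move=> v v1|]; rewrite ?FE//.
  by rewrite rnorm_pair_le1// y1.
by rewrite -gN rnorm_le_opnorm1// (le_trans (rnorm_snd v)).
Qed.

(** For the lower bound at [x], pair [x] with the normalised [T x] and with a functional norming
    [T x]; the resulting state pair yields the value [rnorm (T x)]. *)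
Lemma numerical_radius_corner (T : {linear X -> Y})
    (U : {linear (X * Y)%type -> (X * Y)%type}) :
  continuous T -> (forall z, U z = (0, T z.1)) ->
  continuous U /\ numerical_radius U = opnorm T.
Proof.
move=> Tc UE.
have UT z : rnorm z <= 1 -> rnorm (U z) <= opnorm T.
  move=> z1; rewrite UE rnorm_pair rnorm0 max_r ?rnorm_ge0//=.
  by rewrite rnorm_le_opnorm1// (le_trans (rnorm_fst z)).
have Uc : continuous U by exact: bounded_continuous UT.
split=> //; apply/eqP; rewrite eq_le; apply/andP; split.
  apply: numerical_radius_le; first exact: opnorm_ge0.
  move=> [z F] [/= z1 [Fc FN] _].
  rewrite (le_trans (rnorm_le_opnorm _ Fc))// FN mul1r UT//.
  by rewrite z1.
apply: opnorm_le_bound => [|x x1]; first by rewrite linear0.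
have [->|Tx0] := eqVneq (T x) 0; first by rewrite rnorm0 numerical_radius_ge0.
have n0 := rnorm_gt0 Tx0.
have [g gle gTx] := exists_norming (T x).
have [|F FE xyF] := @state_pairs_snd x (emb (rnorm (T x))^-1 *: T x) g x1.
  apply: state_pairs_norm_le1 => [|v v1|].
  - by rewrite rnormZr gtr0_norm ?invr_gt0// mulVf ?gt_eqF.
  - exact: le_trans (gle v) v1.
  - rewrite linearZ /= gTx.
    have <- : emb ((rnorm (T x))^-1 * rnorm (T x)) = 1.
      by rewrite mulVf ?gt_eqF// real_scalar1.
    by rewrite real_scalarM.
have := numerical_radius_ge Uc xyF; rewrite /= FE UE /= gTx.
by rewrite rnorm_scalar_real ger0_norm// ltW.
Qed.

(* Aligning phases gives ||f|| + ||g|| <= ||F|| = 1 = f x + g y. *)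
Lemma state_pairs_sum (x : X) (y : Y) (F : {linear (X * Y)%type -> K^o}) :
  state_pairs ((x, y), F) ->
  exists (f : {linear X -> K^o}) (g : {linear Y -> K^o}),
    [/\ forall z, F z = f z.1 + g z.2, continuous f, continuous g,
        opnorm f + opnorm g = 1 & g y = emb (opnorm g)].
Proof.
move=> [/= xy1 [Fc FN] Fxy].
have [|f fE] := @exists_linear _ X K^o (fun x => F (x, 0)).
  move=> a u v; rewrite -[RHS]linearP; congr (F _).
  by apply/eqP; rewrite xpair_eqE /= scaler0 addr0 !eqxx.
have [|g gE] := @exists_linear _ Y K^o (fun y => F (0, y)).
  move=> a u v; rewrite -[RHS]linearP; congr (F _).
  by apply/eqP; rewrite xpair_eqE /= scaler0 addr0 !eqxx.
have FE z : F z = f z.1 + g z.2.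
  rewrite fE gE -linearD; congr (F _); case: z => u v.
  by apply/eqP; rewrite xpair_eqE /= add0r addr0 !eqxx.
have fg u v : rnorm u <= 1 -> rnorm v <= 1 -> rnorm (f u) + rnorm (g v) <= 1.
  move=> u1 v1; have [c c1 <-] := rnorm_align (f u) (g v).
  rewrite -linearZ -[f u + _](FE (u, c *: v)) -FN rnorm_le_opnorm1//.
  by rewrite rnorm_pair_le1// rnormZ1.
have fc : continuous f.
  apply: (@bounded_continuous _ _ _ _ _ 1) => u u1.
  by have := fg u 0 u1; rewrite linear0 !rnorm0 addr0; apply.
have gc : continuous g.
  apply: (@bounded_continuous _ _ _ _ _ 1) => v v1.
  by have := fg 0 v; rewrite linear0 !rnorm0 add0r; apply.
have fgN : opnorm f + opnorm g <= 1.
  rewrite -lerBrDr; apply: opnorm_le_bound => [|u u1]; first by rewrite linear0.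
  rewrite lerBrDr -lerBrDl.
  apply: opnorm_le_bound => [|v v1]; first by rewrite linear0.
  by rewrite lerBrDl fg.
have x1 : rnorm x <= 1 by rewrite -xy1 (rnorm_fst (x, y)).
have y1 : rnorm y <= 1 by rewrite -xy1 (rnorm_snd (x, y)).
have fx := rnorm_le_opnorm1 fc x1; have gy := rnorm_le_opnorm1 gc y1.
have : scalar_re (f x) + scalar_re (g y) = 1.
  by rewrite -scalar_reD -(FE (x, y)) Fxy -real_scalar1 scalar_reK.
have := scalar_re_le_rnorm (f x); have := scalar_re_le_rnorm (g y) => gr fr fgr.
exists f, g; split=> //; first by lra.
by apply: eq_real_scalar => //; lra.
Qed.

(* A first component of the functional would make [nu(S)] a proper average of
   itself and of a number at most [D]; a point [x] inside the unit ball would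
   make [x |-> g (S (x, y)).2] constant. *)
Lemma state_pairs_attaining (S : {linear (X * Y)%type -> (X * Y)%type}) (D : R)
    (x : X) (y : Y) (F : {linear (X * Y)%type -> K^o}) :
  continuous S -> state_pairs ((x, y), F) ->
  numerical_radius S = rnorm (F (S (x, y))) -> D < numerical_radius S ->
  (forall z, rnorm z <= 1 -> rnorm (S z).1 <= D) ->
  (forall v, rnorm v <= 1 -> rnorm (S (0, v)).2 <= D) ->
  exists g : {linear Y -> K^o},
    [/\ forall z, F z = g z.2, state_pairs (y, g) & rnorm x = 1].
Proof.
move=> Sc xyF nuS Dnu S1D S2D.
have [xy1 _ _] := xyF; rewrite /unit_sphere /= in xy1.
have x1 : rnorm x <= 1 by rewrite -xy1 (rnorm_fst (x, y)).
have y1 : rnorm y <= 1 by rewrite -xy1 (rnorm_snd (x, y)).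
have [f [g [FE fc gc fgN gy]]] := state_pairs_sum xyF.
have t0 := opnorm_ge0 fc; have s0 := opnorm_ge0 gc.
set W := S (x, y) in nuS.
have W1 : rnorm W.1 <= D by apply: S1D; rewrite xy1.
have D0 : 0 <= D by rewrite (le_trans _ W1) ?rnorm_ge0.
(* Once normalised, [g] is a state at [y], and it tests [S] at the same point [(x, y)]. *)
have gW : rnorm (g W.2) <= opnorm g * numerical_radius S.
  have [s00|] := eqVneq (opnorm g) 0.
    by rewrite (le_trans (rnorm_le_opnorm _ gc))// s00 !mul0r.
  move=> sn0; have sp : 0 < opnorm g by rewrite lt_neqAle eq_sym sn0.
  have [|G GE] := @exists_linear _ Y K^o (fun v => emb (opnorm g)^-1 *: g v).
    by move=> a u v; rewrite linearP scalerDr !scalerA mulrC.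
  have gE v : g v = emb (opnorm g) *: G v.
    by rewrite GE scalerA -real_scalarM mulfV// real_scalar1 scale1r.
  have yG : state_pairs (y, G).
    apply: state_pairs_norm_le1 => // [v v1|].
      rewrite GE rnormZr gtr0_norm ?invr_gt0// ler_pdivrMl// mulr1.
      exact: rnorm_le_opnorm1.
    have <- : emb ((opnorm g)^-1 * opnorm g) = 1.
      by rewrite mulVf// real_scalar1.
    by rewrite GE gy real_scalarM.
  have [F' F'E xyF'] := state_pairs_snd x1 yG.
  have := numerical_radius_ge Sc xyF'; rewrite /= F'E => h.
  by rewrite gE rnormZr gtr0_norm// ler_pM2l.
have f0 : opnorm f = 0.
  have nuW : numerical_radius S <= opnorm f * D + opnorm g * numerical_radius S.
    rewrite {1}nuS FE (le_trans (rnormD _ _))// lerD//.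
    by rewrite (le_trans (rnorm_le_opnorm _ fc))// ler_wpM2l.
  have : opnorm f * (numerical_radius S - D) <= 0.
    have -> : opnorm f = 1 - opnorm g by lra.
    move: nuW; have -> : opnorm f = 1 - opnorm g by lra.
    lra.
  rewrite pmulr_lle0 ?subr_gt0// => t0'.
  by apply/eqP; rewrite eq_le t0' t0.
have g1 : opnorm g = 1 by lra.
have FgE z : F z = g z.2.
  rewrite FE (_ : f z.1 = 0) ?add0r//; apply: rnorm0_eq0; apply/eqP.
  by rewrite eq_le rnorm_ge0 (le_trans (rnorm_le_opnorm _ fc))// f0 mul0r.
have yg : state_pairs (y, g).
  apply: state_pairs_norm_le1 => // [v v1|]; last by rewrite gy g1 real_scalar1.
  by rewrite -g1 rnorm_le_opnorm1.
exists g; split=> //; apply/eqP; rewrite eq_le x1 leNgt; apply/negP => xlt1.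
(* There is room to move [x] by [u * r] times itself. With [u] aligning the phases this would raise
   the value above the numerical radius unless [g] vanishes at [(S (x, 0)).2]; only [S (0, y)] then
   contributes, which is too small. *)
pose r := 1 - rnorm x; have r0 : 0 < r by rewrite /r subr_gt0.
have [u u1 ab] := rnorm_align (g W.2) (emb r *: g (S (x, 0)).2).
have xu : rnorm (x + (u * emb r) *: x) <= 1.
  rewrite (le_trans (rnormD _ _))// -scalerA rnormZ1// rnormZr gtr0_norm//.
  rewrite -lerBrDl -/r ger_pMr//.
have [F' F'E xyF'] := state_pairs_snd xu yg.
have := numerical_radius_ge Sc xyF'; rewrite /= F'E.
have -> : S (x + (u * emb r) *: x, y) = W + (u * emb r) *: S (x, 0).
  rewrite /W -linearZ -linearD; congr (S _).
  by apply/eqP; rewrite xpair_eqE /= scaler0 addr0 !eqxx.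
rewrite /= linearD linearZ /= -scalerA ab nuS FgE rnormZr gtr0_norm//.
rewrite gerDl pmulr_rle0// => gSx.
have gW2 : rnorm (g W.2) <= D.
  have -> : W = S (x, 0) + S (0, y).
    rewrite /W -linearD; congr (S _).
    by apply/eqP; rewrite xpair_eqE /= addr0 add0r !eqxx.
  rewrite /= linearD (le_trans (rnormD _ _))// -[leRHS]add0r lerD//.
  by rewrite (le_trans (rnorm_le_opnorm _ gc))// g1 mul1r S2D.
by move: Dnu; rewrite nuS FgE ltNge gW2.
Qed.

End Sum.

(* For fixed [u], the operator [v |-> (S (g v *: u, phi u *: v)).2] on [Y] has
   numerical radius at most [nu(S)], hence norm at most [nu(S)] because
   [n(Y) = 1]; its value at [y] is [S0 u]. *)
Lemma norm_attaining_corner (R : realType) (k : scalar_kind)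
    (X Y : normedModType (scalars R k))
    (S : {linear (X * Y)%type -> (X * Y)%type}) (x : X) (y : Y)
    (g : {linear Y -> (scalars R k)^o}) :
  numerical_index Y = 1 -> continuous S -> rnorm x = 1 -> state_pairs (y, g) ->
  exists S0 : {linear X -> Y},
    [/\ forall u, rnorm u <= 1 -> rnorm (S0 u) <= numerical_radius S,
        S0 x = (S (x, y)).2 &
        forall u, rnorm u <= 1 ->
          exists2 v, rnorm v <= 1 & S0 u = (S (u, v)).2].
Proof.
move=> nY Sc x1 yg; have [y1 [gc gN] gy] := yg.
rewrite /unit_sphere /= in y1 gc gN gy.
have [phi phi1 phix] := exists_norming x.
have phiE : phi x = 1 by rewrite phix x1 real_scalar1.
have [|S0 S0E] := @exists_linear _ X Y (fun u => (S (u, phi u *: y)).2).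
  move=> a u v; rewrite -[RHS]/((a *: S (u, phi u *: y) + S (v, phi v *: y)).2).
  rewrite -[in RHS]linearP; congr (S _).2; apply/eqP.
  by rewrite xpair_eqE /= linearP scalerDl scalerA !eqxx.
have Spair u v : S (u, v) = S (u, 0) + S (0, v).
  rewrite -linearD; congr (S _).
  by apply/eqP; rewrite xpair_eqE /= addr0 add0r !eqxx.
have S2Z a u : (S (a *: u, 0)).2 = a *: (S (u, 0)).2.
  rewrite -[RHS]/((a *: S (u, 0)).2) -linearZ; congr (S _).2.
  by apply/eqP; rewrite xpair_eqE /= scaler0 !eqxx.
have S2Z' a v : (S (0, a *: v)).2 = a *: (S (0, v)).2.
  rewrite -[RHS]/((a *: S (0, v)).2) -linearZ; congr (S _).2.
  by apply/eqP; rewrite xpair_eqE /= scaler0 !eqxx.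
have phi_le1 u : rnorm u <= 1 -> rnorm (phi u) <= 1.
  by move=> u1; exact: le_trans (phi1 u) u1.
exists S0; split=> [u u1||u u1].
- have [|U UE] := @exists_linear _ Y Y (fun v => (S (g v *: u, phi u *: v)).2).
    move=> a v w; rewrite -[RHS]/(
      (a *: S (g v *: u, phi u *: v) + S (g w *: u, phi u *: w)).2).
    rewrite -[in RHS]linearP; congr (S _).2; apply/eqP.
    rewrite xpair_eqE /= linearP scalerDl scalerDr !scalerA.
    by rewrite (mulrC (phi u)) !eqxx.
  have Uc : continuous U.
    apply: (@bounded_continuous _ _ _ _ _ (opnorm S)) => v v1.
    rewrite UE (le_trans (rnorm_snd _))// rnorm_le_opnorm1// rnorm_pair_le1//.
      rewrite rnormZ (le_trans (ler_piMl (rnorm_ge0 u) _))//.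
      by have := rnorm_le_opnorm1 gc v1; rewrite gN.
    by rewrite rnormZ (le_trans (ler_piMl (rnorm_ge0 v) _))// phi_le1.
  have -> : S0 u = U y by rewrite S0E UE gy scale1r.
  rewrite (le_trans (rnorm_le_opnorm _ Uc))// y1 mulr1.
  rewrite (le_trans (opnorm_le_numerical_radius nY Uc))//.
  apply: numerical_radius_le; first exact: numerical_radius_ge0.
  move=> [v h] vh; have [/= v1 [hc hN] _] := vh; rewrite /unit_sphere /= in v1.
  (* Rotating [u] by [c] makes the two contributions add up in modulus, and [(c *: u, v)] still
     belongs to a state pair. *)
  have [c c1 hE] := rnorm_align (h (S (0, v)).2) (h (S (u, 0)).2).
  apply: (@le_trans _ _ (rnorm (h (S (0, v)).2) + rnorm (h (S (u, 0)).2))).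
    rewrite UE /= Spair /= S2Z S2Z' linearD !linearZ /= addrC.
    rewrite (le_trans (rnormD _ _))// lerD// rnormZ ler_piMl ?rnorm_ge0//.
      exact: phi_le1.
    by have := rnorm_le_opnorm v gc; rewrite gN v1 mulr1.
  have cu : rnorm (c *: u) <= 1 by rewrite rnormZ1.
  have [F FE Fs] := state_pairs_snd cu vh.
  have := numerical_radius_ge Sc Fs.
  rewrite /= FE Spair /= S2Z linearD linearZ /=.
  by rewrite addrC hE.
- by rewrite S0E phiE scale1r.
- exists (phi u *: y); last by rewrite S0E.
  by rewrite rnormZ y1 mulr1; exact: phi_le1.
Qed.

Theorem theorem2p6 (R : realType) (k : scalar_kind)
    (X Y : completeNormedModType (scalars R k)) (eta : R -> R) :
  numerical_index Y = 1 ->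
  weak_BPBp_nu (X * Y)%type eta ->
  BPBZp X Y (fun eps => eta (eps / (4 + eps))).
Proof.
move=> nY wBPB eps /andP[eps0 eps1]; set d := eps / (4 + eps).
have e4 : 0 < 4 + eps by lra.
have d0 : 0 < d by rewrite divr_gt0.
(* This inequality gives the room for all the final estimates. *)
have d4 : 4 * d < eps.
  by rewrite /d mulrA ltr_pdivrMr// mulrC ltr_pM2l//; lra.
have d01 : 0 < d < 1 by rewrite d0/=; lra.
have [eta0 wd] := wBPB d d01; split=> // T g0 x0 Tc TN g0s x01 Tx0.
rewrite /unit_sphere /= in x01.
have [g0c g0N] := g0s.
(* Replacing [g0] costs [2 * e]: small against [d] for the distance of the functionals, and less
   than the gap above [1 - eta d]. *)
pose e := Num.min d (rnorm (g0 (T x0)) - (1 - eta d)) / 4.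
have e0 : 0 < e by rewrite divr_gt0// lt_min d0 subr_gt0.
have ed : 4 * e <= d by rewrite mulrC divfK// ge_min lexx.
have eT : 4 * e <= rnorm (g0 (T x0)) - (1 - eta d).
  by rewrite mulrC divfK// ge_min lexx orbT.
have e01 : 0 < e < 1 by rewrite e0/=; lra.
have [g [y [yg gg0]]] := bishop_phelps g0s e01.
have [y1 [gc gN] gy] := yg; rewrite /unit_sphere /= in y1 gc gN gy.
have [|U UE] :=
  @exists_linear _ (X * Y)%type (X * Y)%type (fun z => (0, T z.1)).
  move=> a z w; apply/eqP; rewrite xpair_eqE /= linearP scaler0 addr0.
  by rewrite !eqxx.
have UE' z : U z = (0, T z.1) by rewrite UE.
have [Uc Unu] := numerical_radius_corner Tc UE'.
have x0le : rnorm x0 <= 1 by rewrite x01.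
have [F0 F0E F0s] := state_pairs_snd x0le yg.
have gg0c : continuous (g \- g0) by move=> v; exact: continuousB (gc v) (g0c v).
have gT : 1 - eta d < rnorm (F0 (U (x0, y))).
  rewrite F0E UE' /=.
  have Tx0N : rnorm (T x0) <= 1 by rewrite -TN rnorm_le_opnorm1.
  have := rnorm_le_opnorm1 gg0c Tx0N; rewrite /= rnormBC => h.
  have := rnormD (g0 (T x0) - g (T x0)) (g (T x0)); rewrite subrK.
  by move: h; lra.
have := wd U (x0, y) F0 Uc F0s; rewrite Unu => /(_ TN gT).
move=> [S [[x1 y1'] [F1 [[Sc F1s Snu] [SU zz FF]]]]].
have SUc : continuous (S \- U) by move=> v; exact: continuousB (Sc v) (Uc v).
set D := opnorm (S \- U) in SU.
have SUD z : rnorm z <= 1 -> rnorm (S z - U z) <= D.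
  by move=> z1; exact: (rnorm_le_opnorm1 SUc).
have nuSD : 1 <= numerical_radius S + D.
  rewrite -TN -Unu; apply: numerical_radius_le.
    by rewrite addr_ge0 ?numerical_radius_ge0 ?opnorm_ge0.
  move=> [z F] zF; have [/= z1 [Fc FN] _] := zF; rewrite /unit_sphere /= in z1.
  rewrite -[U z](subKr (S z)) linearB (le_trans (rnormB _ _))// lerD//.
    exact: (numerical_radius_ge Sc zF).
  by rewrite (le_trans (rnorm_le_opnorm _ Fc))// FN mul1r SUD// z1.
(* Here [D < d < 1 / 4], while the numerical radius is at least [1 - D]. *)
have Dnu : D < numerical_radius S by lra.
(* The operator [U] has its range in [Y] and vanishes on [Y], so on these blocks [S] coincides with
   [S - U]. *)
have S1D z : rnorm z <= 1 -> rnorm (S z).1 <= D.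
  move=> /SUD; apply: le_trans; rewrite (le_trans _ (rnorm_fst _))//.
  by rewrite UE' /= subr0.
have S2D v : rnorm v <= 1 -> rnorm (S (0, v)).2 <= D.
  move=> v1; rewrite (le_trans _ (SUD (0, v) _)) ?rnorm_pair_le1 ?rnorm0//.
  by rewrite (le_trans _ (rnorm_snd _))// UE' /= linear0 subr0.
have [g1 [F1E g1s x11]] := state_pairs_attaining Sc F1s Snu Dnu S1D S2D.
have [S0 [S0le S0x S0S]] := norm_attaining_corner nY Sc x11 g1s.
set nu := numerical_radius S in Snu nuSD Dnu S0le.
have D0 : 0 <= D by exact: opnorm_ge0.
have nu0 : 0 < nu by lra.
(* Both [S0 u] and [T u] are second coordinates at one point [(u, v)], of [S] and of [U]; the value
   of [v] does not affect [U]. *)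
have S0T u : rnorm u <= 1 -> rnorm (S0 u - T u) <= D.
  move=> u1; have [v v1 ->] := S0S u u1.
  have := SUD _ (rnorm_pair_le1 u1 v1); apply: le_trans.
  by rewrite (le_trans _ (rnorm_snd _))// UE'.
have [y11 [g1c g1N] g1y] := g1s; rewrite /unit_sphere /= in y11 g1c g1N g1y.
have x1le : rnorm x1 <= 1 by rewrite x11.
have g1S0 : rnorm (g1 (S0 x1)) = nu by rewrite S0x -F1E -Snu.
have nu1 : nu <= 1 + D.
  rewrite -g1S0 (le_trans (rnorm_le_opnorm _ g1c))// g1N mul1r.
  rewrite -(subrK (T x1) (S0 x1)) addrC (le_trans (rnormD _ _))// lerD ?S0T//.
  by rewrite -TN rnorm_le_opnorm1.
have [|S' S'E] := @exists_linear _ X Y (fun u => real_scalar k nu^-1 *: S0 u).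
  by move=> a u v; rewrite linearP scalerDr !scalerA mulrC.
have S'le u : rnorm u <= 1 -> rnorm (S' u) <= 1.
  move=> u1; rewrite S'E rnormZr gtr0_norm ?invr_gt0// ler_pdivrMl// mulr1.
  exact: S0le.
have S'c : continuous S' by exact: bounded_continuous S'le.
have g1S' : rnorm (g1 (S' x1)) = 1.
  rewrite S'E linearZ /= rnormZr g1S0 gtr0_norm ?invr_gt0//.
  by rewrite mulVf ?gt_eqF.
exists g1, x1, S'; split; split=> //.
- apply/eqP; rewrite eq_le opnorm_le_bound ?linear0//=.
  rewrite -g1S' (le_trans (rnorm_le_opnorm _ g1c))// g1N mul1r.
  exact: rnorm_le_opnorm1.
- apply: le_lt_trans (rnorm_fst ((x1, y1') - (x0, y))) _.
  by apply: lt_trans zz _; lra.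
(* The term [d] comes from [F1 - F0] restricted to [Y], and [2 * e] from the Bishop-Phelps step. *)
- apply: (@le_lt_trans _ _ (d + 2 * e)); last lra.
  have F1c : continuous F1 by case: F1s => _ [].
  have F0c : continuous F0 by case: F0s => _ [].
  have FFc : continuous (F1 \- F0).
    by move=> z; exact: continuousB (F1c z) (F0c z).
  apply: opnorm_le_bound => [|v v1] /=.
    by rewrite (linear0 g1) (linear0 g0) subr0.
  rewrite -(subrKA (g v)) (le_trans (rnormD _ _))// lerD//.
    have v1' : rnorm ((0, v) : (X * Y)%type) <= 1.
      by rewrite rnorm_pair_le1 ?rnorm0.
    have := rnorm_le_opnorm1 FFc v1'; rewrite /= F1E F0E => /le_trans; apply.
    exact: ltW.
  exact: le_trans (rnorm_le_opnorm1 gg0c v1) gg0.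
(* One [D] bounds [S0 - T]; the other bounds the effect of dividing by [nu], which lies within [D]
   of 1. *)
- apply: (@le_lt_trans _ _ (D + D)); last lra.
  apply: opnorm_le_bound => [|u u1] /=.
    by rewrite (linear0 S') (linear0 T) subr0.
  rewrite -(subrKA (S0 u)) (le_trans (rnormD _ _))// lerD ?S0T//.
  have -> : S' u - S0 u = real_scalar k (nu^-1 - 1) *: S0 u.
    by rewrite S'E real_scalarD real_scalarN real_scalar1 scalerBl scale1r.
  rewrite rnormZr; apply: (@le_trans _ _ (`|nu^-1 - 1| * nu)).
    by rewrite ler_wpM2l// S0le.
  rewrite -{2}(gtr0_norm nu0) -normrM mulrBl mulVf ?gt_eqF// mul1r ler_norml.
  by apply/andP; split; lra.
Qed.
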